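(* For all integers $n\ge2$ and $k\ge0$ we have $L_{n,k}<L_{n+1,k}$, and $$L_{n,k}\in\begin{cases}(b_{2k},b_{2k-1})&\text{if }n\ge4,\\ (b_{2k+1},b_{2k})&\text{if }n=3,\\ (b_{2k+2},b_{2k+1})&\text{if }n=2.\end{cases}$$ Also, for all $n\ge2$ and all $k\ge0$, $$\frac{2P_{2k+2}+1}{2P_{2k+2}-1}<L_{n,k}<\frac{H_{2k+1}+1}{H_{2k+1}-1}=\lim_{m\to\infty}L_{m,k},$$ where for $k=0$ the quantity $\frac{H_{1}+1}{H_{1}-1}$ is interpreted as $+\infty$.
   Context: Pell numbers $P_m$ and half-companion Pell numbers $H_m$: $P_0=0,P_1=1$, $H_0=H_1=1$, $P_{m+2}=2P_{m+1}+P_m$, $H_{m+2}=2H_{m+1}+H_m$. For integers $n\ge2,k\ge0$, $$L_{n,k}=\frac{H_{2k}(\sqrt{n^2-1}+1)+2nP_{2k}+(\sqrt{n^2-1}-1)}{H_{2k}(\sqrt{n^2-1}+1)+2nP_{2k}-(\sqrt{n^2-1}-1)}.$$ Set $b_{-1}=\infty$ and, for $m\ge0$, $b_m=1+\frac{2}{P_{m+2}-1}$ if $m$ is even, $b_m=1+\frac{2}{H_{m+1}-1}$ if $m$ is odd. *)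

(* Defs.v *)
From HB Require Import structures.
From mathcomp Require Import all_boot all_order all_algebra.
From mathcomp Require Import all_classical all_reals all_analysis.

Set Implicit Arguments.
Unset Strict Implicit.
Unset Printing Implicit Defensive.

Import Order.TTheory GRing.Theory Num.Theory.
Import numFieldNormedType.Exports.

Local Open Scope ring_scope.

Fixpoint pell (m : nat) : nat :=
  match m with
  | 0 => 0
  | m1.+1 => match m1 with
             | 0 => 1
             | m2.+1 => 2 * pell m1 + pell m2
             end
  end%N.

Fixpoint half_pell (m : nat) : nat :=
  match m with
  | 0 => 1
  | m1.+1 => match m1 with
             | 0 => 1
             | m2.+1 => 2 * half_pell m1 + half_pell m2
             end
  end%N.

(* The mathematical L_{n,k} is only considered for n >= 2; at n = 0 the square
   root of the negative number -1 is 0 by the convention of Num.sqrt. *)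
Definition pellL (R : realType) (n k : nat) : R :=
  let s : R := Num.sqrt (n%:R ^+ 2 - 1) in
  let H : R := (half_pell (2 * k))%:R in
  let P : R := (pell (2 * k))%:R in
  (H * (s + 1) + 2 * n%:R * P + (s - 1)) /
  (H * (s + 1) + 2 * n%:R * P - (s - 1)).

(* The sequence is indexed by m >= -1, hence the type int; the only negative
   index that is meaningful is -1, where the value is infinite. *)
Definition pellb (R : realType) (m : int) : \bar R :=
  match m with
  | Posz j => (if odd j then 1 + 2 / ((half_pell j.+1)%:R - 1)
               else 1 + 2 / ((pell j.+2)%:R - 1))%:E
  | Negz _ => +oo%E
  end.

(* (H_{2k+1} + 1) / (H_{2k+1} - 1), where the quotient 2 / 0 arising at k = 0
   is read as +oo (in R it would be 0). *)
Definition pellLsup (R : realType) (k : nat) : \bar R :=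
  if k == 0%N then +oo%E
  else (((half_pell (2 * k).+1)%:R + 1) / ((half_pell (2 * k).+1)%:R - 1))%:E.

(* Main.v *)
(** Write [H = H_{2k}], [P = P_{2k}], [s = sqrt (n^2 - 1)] and [t = s - 1].
    Then [L_{n,k} = (x + 1) / (x - 1)] with [x = (H (s + 1) + 2 n P) / t], and
    [y |-> (y + 1) / (y - 1)] is decreasing for [y > 1].  Every quantity that
    [L_{n,k}] is compared with is the image of some [y = a H + b P], because
    [H_{2k+1} = H + 2P], [P_{2k+2} = 2H + 3P], [H_{2k+2} = 3H + 4P] and
    [P_{2k+4} = 12H + 17P].  So each claim reduces to comparing [x] with [y]
    coefficient by coefficient, i.e. [s + 1] with [a t] and [2 n] with [b t]. *)
Require Import Defs.
From HB Require Import structures.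
From mathcomp Require Import all_boot all_order all_algebra.
From mathcomp Require Import all_classical all_reals all_analysis.
From mathcomp Require Import ring lra zify.

Set Implicit Arguments.
Unset Strict Implicit.
Unset Printing Implicit Defensive.

Import Order.TTheory GRing.Theory Num.Theory.
Import numFieldNormedType.Exports.

Local Open Scope classical_set_scope.
Local Open Scope ring_scope.

(** * First-order recurrences for the Pell numbers *)

(** This is multiplication of [H_m + P_m sqrt 2 = (1 + sqrt 2)^m] by [1 + sqrt 2]. The induction
    step of each identity uses both, so they are proved together. *)
Lemma half_pell_pellS m :
  half_pell m.+1 = (half_pell m + 2 * pell m)%N /\
  pell m.+1 = (half_pell m + pell m)%N.
Proof.
elim: m => [//|m [IHh IHp]].
have -> : half_pell m.+2 = (2 * half_pell m.+1 + half_pell m)%N by [].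
have -> : pell m.+2 = (2 * pell m.+1 + pell m)%N by [].
lia.
Qed.

Lemma half_pellS m : half_pell m.+1 = (half_pell m + 2 * pell m)%N.
Proof. by case: (half_pell_pellS m). Qed.

Lemma pellS m : pell m.+1 = (half_pell m + pell m)%N.
Proof. by case: (half_pell_pellS m). Qed.

Lemma half_pell_gt0 m : (0 < half_pell m)%N.
Proof. by elim: m => // m IH; rewrite half_pellS; lia. Qed.

Lemma pell_gt0 m : (0 < m)%N -> (0 < pell m)%N.
Proof. by case: m => // m _; rewrite pellS; have := half_pell_gt0 m; lia. Qed.

(** * Bounds on [sqrt (n^2 - 1)] and comparison of ratios *)

Section PellL.
Variable R : realType.

Let s n : R := Num.sqrt (n%:R ^+ 2 - 1).

Lemma natr_ge n m : (m <= n)%N -> m%:R <= n%:R :> R.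
Proof. by rewrite ler_nat. Qed.

Lemma sqr_s n : (2 <= n)%N -> s n ^+ 2 = n%:R ^+ 2 - 1.
Proof. by move=> /natr_ge n2; rewrite sqr_sqrtr//; nra. Qed.

Lemma s_ge0 n : 0 <= s n. Proof. exact: sqrtr_ge0. Qed.

Lemma s_gt1 n : (2 <= n)%N -> 1 < s n.
Proof.
by move=> n2; have := sqr_s n2; have := s_ge0 n; have := natr_ge n2; nra.
Qed.

Lemma s_lt n : (2 <= n)%N -> s n < n%:R.
Proof.
by move=> n2; have := sqr_s n2; have := s_ge0 n; have := natr_ge n2; nra.
Qed.

Lemma s_gt n : (2 <= n)%N -> n%:R - 1 < s n.
Proof.
by move=> n2; have := sqr_s n2; have := s_ge0 n; have := natr_ge n2; nra.
Qed.

(** The numerator of [x]: [x = num n k / (s n - 1)], so [x < y] is stated without division as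
    [num n k < y * (s n - 1)]. *)
Let num n k : R := (half_pell (2 * k))%:R * (s n + 1)
  + 2 * n%:R * (pell (2 * k))%:R.

Lemma pellLE n k : pellL R n k = (num n k + (s n - 1)) / (num n k - (s n - 1)).
Proof. by []. Qed.

Lemma num_gt n k : (2 <= n)%N -> s n - 1 < num n k.
Proof.
move=> n2; rewrite /num.
have h1 : 1 <= (half_pell (2 * k))%:R :> R by exact: natr_ge (half_pell_gt0 _).
have p0 : 0 <= (pell (2 * k))%:R :> R by [].
have /= := natr_ge n2; have := s_gt1 n2; nra.
Qed.

(** After cross-multiplication by the positive denominators, [a * b] and [t * u] cancel, leaving
    twice the claim. *)
Lemma ratio_lt (a t b u : R) : t < a -> u < b ->
  ((a + t) / (a - t) < (b + u) / (b - u)) = (b * t < a * u).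
Proof.
move=> ta ub; rewrite ltr_pdivrMr ?subr_gt0// mulrAC ltr_pdivlMr ?subr_gt0//.
by apply/idP/idP => h; lra.
Qed.

Lemma pellL_gt n k (y : R) : (2 <= n)%N -> 1 < y ->
  num n k < y * (s n - 1) -> (y + 1) / (y - 1) < pellL R n k.
Proof.
by move=> n2 y1 h; rewrite pellLE ratio_lt ?num_gt// mulr1.
Qed.

Lemma pellL_lt n k (y : R) : (2 <= n)%N -> 1 < y ->
  y * (s n - 1) < num n k -> pellL R n k < (y + 1) / (y - 1).
Proof.
by move=> n2 y1 h; rewrite pellLE ratio_lt ?num_gt// mulr1.
Qed.

Lemma pellb_ratio (y : R) : 1 < y -> 1 + 2 / (y - 1) = (y + 1) / (y - 1).
Proof. by move=> y1; field; lra. Qed.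

(** [P_{2k}] vanishes at [k = 0], so strictness is taken from the coefficient of [H_{2k} > 0]. *)
Lemma num_lt_lin n k (a b : R) : s n + 1 < a * (s n - 1) ->
  2 * n%:R <= b * (s n - 1) ->
  num n k < (a * (half_pell (2 * k))%:R + b * (pell (2 * k))%:R) * (s n - 1).
Proof.
move=> ha hb; rewrite /num.
have h1 : 0 < (half_pell (2 * k))%:R :> R by rewrite ltr0n half_pell_gt0.
have p0 : 0 <= (pell (2 * k))%:R :> R by [].
by have := ltr_pM2l h1 (s n + 1) (a * (s n - 1)); rewrite ha => ?;
  have := ler_wpM2l p0 hb; lra.
Qed.

Lemma num_gt_lin n k (a b : R) : a * (s n - 1) < s n + 1 ->
  b * (s n - 1) <= 2 * n%:R ->
  (a * (half_pell (2 * k))%:R + b * (pell (2 * k))%:R) * (s n - 1) < num n k.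
Proof.
move=> ha hb; rewrite /num.
have h1 : 0 < (half_pell (2 * k))%:R :> R by rewrite ltr0n half_pell_gt0.
have p0 : 0 <= (pell (2 * k))%:R :> R by [].
by have := ltr_pM2l h1 (a * (s n - 1)) (s n + 1); rewrite ha => ?;
  have := ler_wpM2l p0 hb; lra.
Qed.

Lemma pellL_lin_lt n k y a b : (2 <= n)%N -> (1 < y)%N ->
  y = (a * half_pell (2 * k) + b * pell (2 * k))%N ->
  a%:R * (s n - 1) < s n + 1 -> b%:R * (s n - 1) <= 2 * n%:R ->
  pellL R n k < (y%:R + 1) / (y%:R - 1).
Proof.
move=> n2 y1 yE ha hb; apply: pellL_lt; rewrite ?ltr1n//.
by rewrite yE natrD !natrM num_gt_lin.
Qed.

Lemma pellL_lin_gt n k y a b : (2 <= n)%N -> (1 < y)%N ->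
  y = (a * half_pell (2 * k) + b * pell (2 * k))%N ->
  s n + 1 < a%:R * (s n - 1) -> 2 * n%:R <= b%:R * (s n - 1) ->
  (y%:R + 1) / (y%:R - 1) < pellL R n k.
Proof.
move=> n2 y1 yE ha hb; apply: pellL_gt; rewrite ?ltr1n//.
by rewrite yE natrD !natrM num_lt_lin.
Qed.

(** * The bounds [b_m] as values of [(y + 1) / (y - 1)] *)

Lemma pellb_even k : pellb R (2 * k%:Z) =
  (((pell (2 * k).+2)%:R + 1) / ((pell (2 * k).+2)%:R - 1))%:E.
Proof.
rewrite -PoszM /pellb mul2n odd_double pellb_ratio// ltr1n.
by rewrite 2!pellS half_pellS; have := half_pell_gt0 k.*2; lia.
Qed.

Lemma pellb_odd k : pellb R (2 * k%:Z + 1) =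
  (((half_pell (2 * k).+2)%:R + 1) / ((half_pell (2 * k).+2)%:R - 1))%:E.
Proof.
rewrite -PoszM -PoszD addn1 /pellb mul2n /= odd_double /= pellb_ratio// ltr1n.
rewrite -[ltnRHS]/(half_pell k.*2.+2) 2!half_pellS pellS.
by have := half_pell_gt0 k.*2; lia.
Qed.

(** * Monotonicity, supremum and limit in [n] *)

(** After cross-multiplication, the [H] part amounts to [s n < s n.+1], and the [P] part to
    [(n + 1) * s n - 1 <= n * s n.+1]. *)
Lemma pellL_ltS n k : (2 <= n)%N -> pellL R n k < pellL R n.+1 k.
Proof.
move=> n2; have n2' : (2 <= n.+1)%N by lia.
rewrite !pellLE ratio_lt ?num_gt// /num.
have /= hn := natr_ge n2.
have [e e'] := (sqr_s n2, sqr_s n2').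
have [g g'] := (s_gt1 n2, s_gt1 n2').
move: e'; rewrite -natr1 => e'.
have lt_s : s n < s n.+1 by nra.
have h1 : 0 < (half_pell (2 * k))%:R :> R by rewrite ltr0n half_pell_gt0.
have p0 : 0 <= (pell (2 * k))%:R :> R by [].
(* That is, [s n / n = sqrt (1 - 1 / n^2)] grows with [n]; checked on squares. *)
have le_ns : (n%:R + 1) * s n <= n%:R * s n.+1.
  rewrite -(@ler_pXn2r _ 2) ?nnegrE ?mulr_ge0 ?s_ge0 ?ler_wpDr// !exprMn e e'.
  by lra.
have := mulr_gt0 h1 (_ : 0 < s n.+1 - s n); rewrite subr_gt0 => /(_ lt_s) ?.
have := ler_wpM2l p0 le_ns; lra.
Qed.

Lemma pellL_lt_sup n k : (2 <= n)%N -> ((pellL R n k)%:E < pellLsup R k)%E.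
Proof.
move=> n2; rewrite /pellLsup; case: eqP => [_|k0]; first exact: ltry.
rewrite lte_fin; apply: (@pellL_lin_lt _ _ _ 1 2) => //.
- by rewrite half_pellS; have := half_pell_gt0 (2 * k);
    have := @pell_gt0 (2 * k); lia.
- by rewrite half_pellS mul1n.
- by lra.
- by have := s_lt n2; lra.
Qed.

(* [L_{m,0}] is just [sqrt (m^2 - 1)]. *)
Lemma cvg_pellL0 : pellL R m 0 @[m --> \oo] --> +oo.
Proof.
apply/cvgryPge => A; near=> m.
have m2 : (2 <= m)%N by near: m; exact: nbhs_infty_ge.
have Am : A + 1 <= m%:R by near: m; exact: nbhs_infty_ger.
rewrite pellLE /num /= mul1r mulr0 addr0.
have -> : (s m + 1 + (s m - 1)) / (s m + 1 - (s m - 1)) = s m by field; lra.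
by have := s_gt m2; lra.
Unshelve. all: by end_near. Qed.

(** The gap to the limit is [O(1/m)]: [num m k] exceeds [y * (s m - 1)] by a bounded amount, while
    the denominator grows linearly in [m]. *)
Lemma cvg_pellL k : (0 < k)%N ->
  pellL R m k @[m --> \oo] -->
  (((half_pell (2 * k).+1)%:R + 1) / ((half_pell (2 * k).+1)%:R - 1) : R).
Proof.
move=> k0; set y : R := (half_pell (2 * k).+1)%:R.
set c : R := 2 * (half_pell (2 * k))%:R + 4 * (pell (2 * k))%:R.
have h1 : 1 <= (half_pell (2 * k))%:R :> R by exact: natr_ge (half_pell_gt0 _).
have p1 : 1 <= (pell (2 * k))%:R :> R.
  by apply: natr_ge (pell_gt0 _); lia.
have yE : y = (half_pell (2 * k))%:R + 2 * (pell (2 * k))%:R.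
  by rewrite /y half_pellS natrD natrM.
have y1 : 1 < y by lra.
set l := (y + 1) / (y - 1).
apply: (@squeeze_cvgr _ _ _ _ (fun m => l - 10 * c * harmonic m) (fun=> l)).
- near=> m.
  have m4 : (4 <= m)%N by near: m; exact: nbhs_infty_ge.
  have m2 : (2 <= m)%N by lia.
  apply/andP; split; last first.
    have := pellL_lt_sup k m2; rewrite /pellLsup; case: eqP => [|_]; first by lia.
    by rewrite lte_fin => /ltW.
  have [[hs hs'] hs1] := (s_gt m2, s_lt m2, s_gt1 m2).
  have /= hm := natr_ge m4.
  (* The excess is [2 H + 2 P (m - s m + 1)], and [m - s m < 1]. *)
  have ub : num m k <= y * (s m - 1) + c by rewrite /num yE /c; nra.
  have lb : y * (s m - 1) <= num m k by rewrite /num yE; nra.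
  (* The left side is at least [s m - 1 > m - 2], hence at least [(m + 1) / 5] for [m >= 4]. With
     the factor 2 in [dE] this gives the constant 10. *)
  have lb' : (m%:R + 1) / 5 <= num m k - (s m - 1) by nra.
  have dE : l - pellL R m k =
      2 * (num m k - y * (s m - 1)) / ((y - 1) * (num m k - (s m - 1))).
    by rewrite /l pellLE; field; apply/andP; split; lra.
  rewrite lerBlDr -lerBlDl dE /harmonic/= -natr1.
  have y2 : 1 <= y - 1 by lra.
  rewrite ler_pdivrMr; last by apply: mulr_gt0; lra.
  rewrite mulrAC ler_pdivlMr; last by lra.
  have le1 : 2 * (num m k - y * (s m - 1)) * (m%:R + 1) <= 2 * c * (m%:R + 1).
    by apply: ler_wpM2r; lra.
  have c0 : 0 <= c by rewrite /c; lra.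
  have le2 : (m%:R + 1) / 5 <= (y - 1) * (num m k - (s m - 1)) by nra.
  by have := ler_wpM2l c0 le2; lra.
- rewrite -[X in _ --> X]subr0 -[X in _ - X](mulr0 (10 * c)).
  by apply: cvgB; [exact: cvg_cst|apply: cvgM; [exact: cvg_cst|exact: cvg_harmonic]].
- exact: cvg_cst.
Unshelve. all: by end_near. Qed.

(** * The uniform lower bound and the intervals between the [b_m] *)

(** Here [y = 2 P_{2k+2} = 4 H + 6 P]. The tightest case is [n = 2], where both coefficient
    conditions follow from [sqrt 3 > 5/3]. *)
Lemma pellL_gt_lower n k : (2 <= n)%N ->
  (2 * (pell (2 * k + 2))%:R + 1) / (2 * (pell (2 * k + 2))%:R - 1)
    < pellL R n k.
Proof.
move=> n2; rewrite -natrM; apply: (@pellL_lin_gt _ _ _ 4 6) => //.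
- by rewrite addn2 2!pellS half_pellS; have := half_pell_gt0 (2 * k); lia.
- by rewrite addn2 2!pellS half_pellS; lia.
- by have := sqr_s n2; have := s_gt1 n2; have /= := natr_ge n2; nra.
- by have := sqr_s n2; have := s_gt1 n2; have /= := natr_ge n2; nra.
Qed.

Lemma in_itv_oo (a b x : \bar R) : (x \in `]a, b[) = ((a < x) && (x < b))%E.
Proof. by rewrite in_itv. Qed.

Lemma pellL_itv_ge4 n k : (4 <= n)%N ->
  (pellL R n k)%:E \in `]pellb R (2 * k%:Z), pellb R (2 * k%:Z - 1)[.
Proof.
move=> n4; have n2 : (2 <= n)%N by lia.
rewrite pellb_even in_itv_oo; apply/andP; split.
  (* The [H] condition says [s n > 3], which holds because [s n > n - 1]. *)
  rewrite lte_fin; apply: (@pellL_lin_gt _ _ _ 2 3) => //.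
  - by rewrite 2!pellS half_pellS; have := half_pell_gt0 (2 * k); lia.
  - by rewrite 2!pellS half_pellS; lia.
  - by have := s_gt n2; have /= := natr_ge n4; nra.
  - by have := sqr_s n2; have := s_gt1 n2; have /= := natr_ge n4; nra.
(* At [k = 0] the upper end is [b_{-1} = +oo]; otherwise [b_{2k-1}] corresponds to [y = H_{2k}],
   with coefficients 1 and 0. *)
case: k => [|k]; first exact: ltry.
have -> : 2 * k.+1%:Z - 1 = 2 * k%:Z + 1 by lia.
have e : (2 * k).+2 = (2 * k.+1)%N by lia.
rewrite pellb_odd lte_fin e; apply: (@pellL_lin_lt _ _ _ 1 0) => //.
- rewrite -e 2!half_pellS pellS; have := half_pell_gt0 (2 * k); lia.
- by lia.
- by lra.
- by have /= := natr_ge n4; nra.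
Qed.

(** Since [s 3 = sqrt 8 < 3], the comparison with [b_{2k}] is reversed; [s 3 >= 5/2] gives the lower
    end. *)
Lemma pellL_itv3 k :
  (pellL R 3 k)%:E \in `]pellb R (2 * k%:Z + 1), pellb R (2 * k%:Z)[.
Proof.
have e : s 3 ^+ 2 = 3 ^+ 2 - 1 := sqr_s (isT : (2 <= 3)%N).
have g : 1 < s 3 := s_gt1 (isT : (2 <= 3)%N).
rewrite pellb_even pellb_odd in_itv_oo !lte_fin; apply/andP; split.
  apply: (@pellL_lin_gt _ _ _ 3 4) => //.
  - by rewrite 2!half_pellS pellS; have := half_pell_gt0 (2 * k); lia.
  - by rewrite 2!half_pellS pellS; lia.
  - by nra.
  - by nra.
apply: (@pellL_lin_lt _ _ _ 2 3) => //.
- by rewrite 2!pellS half_pellS; have := half_pell_gt0 (2 * k); lia.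
- by rewrite 2!pellS half_pellS; lia.
- by nra.
- by nra.
Qed.

(** The upper end needs [sqrt 3 < 2], the lower end [sqrt 3 >= 21/17]. *)
Lemma pellL_itv2 k :
  (pellL R 2 k)%:E \in `]pellb R (2 * k%:Z + 2), pellb R (2 * k%:Z + 1)[.
Proof.
have e : s 2 ^+ 2 = 2 ^+ 2 - 1 := sqr_s (isT : (2 <= 2)%N).
have g : 1 < s 2 := s_gt1 (isT : (2 <= 2)%N).
have -> : 2 * k%:Z + 2 = 2 * k.+1%:Z by lia.
have e2 : (2 * k.+1 = (2 * k).+2)%N by lia.
rewrite pellb_even pellb_odd e2 in_itv_oo !lte_fin; apply/andP; split.
  apply: (@pellL_lin_gt _ _ _ 12 17) => //.
  - by rewrite !(pellS, half_pellS); have := half_pell_gt0 (2 * k); lia.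
  - by rewrite !(pellS, half_pellS); lia.
  - by nra.
  - by nra.
apply: (@pellL_lin_lt _ _ _ 3 4) => //.
- by rewrite 2!half_pellS pellS; have := half_pell_gt0 (2 * k); lia.
- by rewrite 2!half_pellS pellS; lia.
- by nra.
- by nra.
Qed.

End PellL.

Theorem proposition4p14 (R : realType) :
  (forall n k : nat, (2 <= n)%N ->
     pellL R n k < pellL R n.+1 k
     /\ [/\ (4 <= n)%N ->
              (pellL R n k)%:E
                \in `]pellb R (2 * k%:Z), pellb R (2 * k%:Z - 1)[,
            n = 3%N ->
              (pellL R n k)%:E
                \in `]pellb R (2 * k%:Z + 1), pellb R (2 * k%:Z)[
          & n = 2%N ->
              (pellL R n k)%:E
                \in `]pellb R (2 * k%:Z + 2), pellb R (2 * k%:Z + 1)[]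
     /\ (2 * (pell (2 * k + 2))%:R + 1) / (2 * (pell (2 * k + 2))%:R - 1)
          < pellL R n k
     /\ ((pellL R n k)%:E < pellLsup R k)%E)
  /\ (forall k : nat, (pellL R m k)%:E @[m --> \oo] --> pellLsup R k).
Proof.
split=> [n k n2|k].
  split; first exact: pellL_ltS.
  split; last by split; [exact: pellL_gt_lower|exact: pellL_lt_sup].
  split=> [|->|->]; [exact: pellL_itv_ge4|exact: pellL_itv3|exact: pellL_itv2].
rewrite /pellLsup; case: eqP => [->|/eqP k0].
  by apply/cvgeryP; exact: cvg_pellL0.
by apply: cvg_EFin; [exact: nearW|apply: cvg_pellL; rewrite lt0n].
Qed.
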